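(* There is a polynomial-time many-one reduction from the Maximum Directed Cut decision problem to the Maximum Directed Linear Arrangement decision problem.
   Context: MaxDiCut: given a digraph $D$ and integer $k$, decide whether there is a partition $\{S,T\}$ of $V(D)$ such that at least $k$ edges have tail in $S$ and head in $T$. MaxDLA: given an $n$-vertex digraph $D$ and integer $k$, decide whether there is a bijection $\pi:V(D)\to\{1,\dots,n\}$ with $\sum_{(u,v)\in E(D)}\max\{0,\pi(v)-\pi(u)\}\ge k$. *)

(* Defs.v *)
From HB Require Import structures.
From Corelib Require Import PosDef.
From mathcomp Require Import all_boot all_order all_algebra.

Set Implicit Arguments.
Unset Strict Implicit.
Unset Printing Implicit Defensive.

Import Order.TTheory GRing.Theory Num.Theory.

(** * Deterministic multitape Turing machines over the input alphabet {0,1} *)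

Inductive move := MoveL | Stay | MoveR.

Record turing_machine := TuringMachine {
  tm_last_tape : nat; (* there are tm_last_tape.+1 >= 1 tapes *)
  tm_state : finType;
  tm_sym : finType;
  tm_blank : tm_sym;
  tm_bit : bool -> tm_sym;
  tm_bit_inj : injective tm_bit;
  tm_bit_blank : forall b, tm_bit b != tm_blank;
  tm_start : tm_state;
  tm_halting : pred tm_state;
  tm_delta : tm_state -> {ffun 'I_tm_last_tape.+1 -> tm_sym} ->
             tm_state * {ffun 'I_tm_last_tape.+1 -> tm_sym * move}
}.

Section Runs.
Variable M : turing_machine.

(* A two-way infinite tape [(l, r)]: [r] is read from the scanned cell
   rightwards, [l] from the cell left of it leftwards; all the cells beyond the
   two sequences are blank. *)
Definition tape := (seq (tm_sym M) * seq (tm_sym M))%type.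

Definition scanned (t : tape) : tm_sym M := head (tm_blank M) t.2.

Definition tape_act (a : tm_sym M * move) (t : tape) : tape :=
  match a.2 with
  | MoveL => (behead t.1, head (tm_blank M) t.1 :: a.1 :: behead t.2)
  | Stay => (t.1, a.1 :: behead t.2)
  | MoveR => (a.1 :: t.1, behead t.2)
  end.

Definition config :=
  (tm_state M * {ffun 'I_(tm_last_tape M).+1 -> tape})%type.

Definition halted (c : config) : bool := tm_halting c.1.

Definition tm_step (c : config) : config :=
  if halted c then c else
  let: (q, a) := tm_delta c.1 [ffun i => scanned (c.2 i)] in
  (q, [ffun i => tape_act (a i) (c.2 i)]).

(* The input is on the first tape, with its first symbol scanned. *)
Definition tm_init (w : seq bool) : config :=
  (tm_start M,
   [ffun i => if i == ord0 then ([::], map (@tm_bit M) w) else ([::], [::])]).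

(* The output is on the last tape, from the scanned cell up to the first
   blank. *)
Definition tm_output (c : config) (w : seq bool) : Prop :=
  exists2 r, (c.2 ord_max).2 = map (@tm_bit M) w ++ r
           & head (tm_blank M) r = tm_blank M.

Definition outputs_within (w : seq bool) (T : nat) (w' : seq bool) : Prop :=
  exists2 t, t <= T
           & let c := iter t tm_step (tm_init w) in halted c /\ tm_output c w'.

End Runs.

(** * Decision problems and polynomial-time many-one reductions *)

Record decision_problem := DecisionProblem {
  instance : Type;
  encode : instance -> seq bool;
  encode_inj : injective encode;
  yes_instance : instance -> Prop
}.

Definition polytime_computable (X Y : Type) (encX : X -> seq bool)
    (encY : Y -> seq bool) (f : X -> Y) : Prop :=
  exists (M : turing_machine) (p : {poly nat}),
    forall x, outputs_within M (encX x) p.[size (encX x)]%R (encY (f x)).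

Definition polytime_many_one_reducible (A B : decision_problem) : Prop :=
  exists2 f : instance A -> instance B,
    polytime_computable (@encode A) (@encode B) f
    & forall x, yes_instance x <-> yes_instance (f x).

(** * Digraphs and the binary encoding of pairs (digraph, integer) *)

(* Finite digraphs without loops or parallel arcs, up to renaming the
   vertices. *)
Record digraph := Digraph {
  dg_order : nat;
  arcs : {set 'I_dg_order * 'I_dg_order};
  arcs_loopless : [forall v, (v, v) \notin arcs]
}.

Fixpoint pos_bits (p : positive) : seq bool :=
  match p with
  | xH => [:: true]
  | xO p' => false :: pos_bits p'
  | xI p' => true :: pos_bits p'
  end.

(* Binary notation, least significant bit first; 0 is the empty word. *)
Definition nat_bits (n : nat) : seq bool :=
  if bin_of_nat n is Npos p then pos_bits p else [::].

Definition int_bits (k : int) : seq bool :=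
  (k < 0)%R :: nat_bits `|k|%N.

Definition adjacency_bits (D : digraph) : seq bool :=
  [seq (u, v) \in arcs D | u <- enum 'I_(dg_order D), v <- enum 'I_(dg_order D)].

(* 1^n 0, then the n * n adjacency matrix row by row, then the integer in
   binary. *)
Definition encode_digraph_int (x : digraph * int) : seq bool :=
  nseq (dg_order x.1) true ++ false :: adjacency_bits x.1 ++ int_bits x.2.

Lemma pos_bits_inj : injective pos_bits.
Proof.
have nz p : pos_bits p != [::] by case: p.
elim=> [p IH|p IH|] [q|q|] //=.
- by case=> /IH ->.
- by case=> e; have := nz p; rewrite e.
- by case=> /IH ->.
- by case=> e; have := nz q; rewrite -e.
Qed.

Lemma nat_bits_inj : injective nat_bits.
Proof.
move=> m n; rewrite /nat_bits => e; apply: (can_inj bin_of_natK).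
have nz p : pos_bits p <> [::] by case: p.
case: (bin_of_nat m) (bin_of_nat n) e => [|p] [|q] //.
- by move/esym/nz.
- by move/nz.
- by move/pos_bits_inj ->.
Qed.

Lemma int_bits_inj : injective int_bits.
Proof.
by move=> [m|m] [n|n] //= [] /nat_bits_inj => [->|/= [->]].
Qed.

Lemma encode_digraph_int_inj : injective encode_digraph_int.
Proof.
move=> [[n A hA] k] [[m B hB] l] e.
have enm : n = m.
  move: e; rewrite /encode_digraph_int /=.
  move: (adjacency_bits _ ++ _) (adjacency_bits _ ++ _) => s s'; clear.
  by elim: n m => [|n IH] [|m] //= [] /IH ->.
subst m; move: e => /eqP; rewrite /encode_digraph_int /= eqseq_cat //.
rewrite eqxx /= eqseq_cons eqxx /=.
rewrite eqseq_cat; last by rewrite !size_allpairs.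
case/andP=> /eqP eA /eqP/int_bits_inj ->; congr (_, _).
have eAB : A = B.
  apply/setP => -[u v].
  have /eq_in_allpairs eq_arcs := eA.
  by apply: eq_arcs; rewrite mem_enum.
by subst B; congr Digraph; apply: eq_irrelevance.
Qed.

(** * The two problems *)

(* The parts of a cut may be empty. *)
Definition has_dicut (x : digraph * int) : Prop :=
  let: (D, k) := x in
  exists S T : {set 'I_(dg_order D)},
    [/\ S :|: T = [set: 'I_(dg_order D)], [disjoint S & T]
      & (k <= #|[set e in arcs D | (e.1 \in S) && (e.2 \in T)]|%:Z)%R].

Definition MaxDiCut : decision_problem :=
  DecisionProblem encode_digraph_int_inj has_dicut.

(* [pi v : 'I_n] ranges over 0..n-1, so that the position of [v] in 1..n is
   [(pi v).+1]. *)
Definition has_linear_arrangement (x : digraph * int) : Prop :=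
  let: (D, k) := x in
  exists2 pi : 'I_(dg_order D) -> 'I_(dg_order D), bijective pi
    & (k <= \sum_(e in arcs D)
              Num.max 0 ((pi e.2).+1%:Z - (pi e.1).+1%:Z))%R.

Definition MaxDLA : decision_problem :=
  DecisionProblem encode_digraph_int_inj has_linear_arrangement.

(* Main.v *)
Require Import Defs.
From HB Require Import structures.
From Corelib Require Import PosDef.
From mathcomp Require Import all_boot all_order all_algebra.
From mathcomp Require Import zify.

Set Implicit Arguments.
Unset Strict Implicit.
Unset Printing Implicit Defensive.

Import Order.TTheory GRing.Theory Num.Theory.

(* Add N > n^3 isolated vertices to a digraph D of order n, and multiply k by N.
   Placing a cut {S, T} as S, then the new vertices, then T gives each cut arc a
   length above N. Conversely, the value of an arrangement is the sum, over the
   n + N places where it can be split, of the sizes of the directed cuts of D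
   induced by the splits; if all of them have at most c <= n^2 arcs, this is at
   most c (n + N) < (c + 1) N.

   N is a power of two, so that multiplying k by N inserts zeros in its binary
   notation. The reduction is written in a small language of programs on stacks,
   each of which is kept on one tape with its top under the head. *)

(** * Padding a digraph with isolated vertices *)

Section Padding.
Variables (N : nat).

Definition pad_arc n (e : 'I_n * 'I_n) : 'I_(n + N) * 'I_(n + N) :=
  (lshift N e.1, lshift N e.2).

Lemma pad_arc_inj n : injective (@pad_arc n).
Proof. by move=> [u v] [u' v'] [/val_inj -> /val_inj ->]. Qed.

Lemma pad_loopless (D : digraph) :
  [forall v, (v, v) \notin @pad_arc (dg_order D) @: arcs D].
Proof.
apply/forallP => v; apply/imsetP => -[[a b] ab [-> /lshift_inj e]].
by move: (forallP (arcs_loopless D) a); rewrite {2}e ab.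
Qed.

Definition pad (D : digraph) : digraph := Digraph (pad_loopless D).

(** Truncated subtraction on [nat] supplies the maximum with 0 in the value of an arrangement. *)
Definition length n (pi : 'I_n -> 'I_n) (e : 'I_n * 'I_n) := pi e.2 - pi e.1.

Lemma sum_maxE n (pi : 'I_n -> 'I_n) (A : {set 'I_n * 'I_n}) :
  (\sum_(e in A) Num.max 0 ((pi e.2).+1%:Z - (pi e.1).+1%:Z)
   = (\sum_(e in A) length pi e)%N%:Z)%R.
Proof.
rewrite (big_morph Posz PoszD erefl); apply: eq_bigr => e _.
rewrite /length; case: (leqP (pi e.1) (pi e.2)) => [le|/ltnW le].
  by rewrite max_r ?subr_ge0 ?lez_nat // subzn.
by rewrite max_l ?subr_le0 ?lez_nat // (eqP le).
Qed.

Lemma sum_pad D (F : 'I_(dg_order D + N) * 'I_(dg_order D + N) -> nat) :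
  \sum_(e in arcs (pad D)) F e = \sum_(e in arcs D) F (pad_arc e).
Proof. by rewrite big_imset //; apply: in2W; apply: pad_arc_inj. Qed.

Lemma dicut_arrangement (D : digraph) (S T : {set 'I_(dg_order D)}) :
  S :|: T = setT -> [disjoint S & T] ->
  exists2 pi : 'I_(dg_order D + N) -> 'I_(dg_order D + N), bijective pi &
    #|[set e in arcs D | (e.1 \in S) && (e.2 \in T)]| * N
      <= \sum_(e in arcs (pad D)) length pi e.
Proof.
set n := dg_order D => ST dST.
pose q1 := map (@lshift n N) (enum S).
pose q2 := map (@rshift n N) (enum 'I_N).
pose q3 := map (@lshift n N) (enum T).
pose q := q1 ++ q2 ++ q3.
have sq1 : size q1 = #|S| by rewrite size_map -cardE.
have sq2 : size q2 = N by rewrite size_map size_enum_ord.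
have sq : size q = n + N.
  rewrite !size_cat sq1 sq2 size_map -cardE addnCA addnC.
  by rewrite -cardsUI ST (disjoint_setI0 dST) cards0 addn0 cardsT card_ord.
have inq v : v \in q.
  rewrite !mem_cat; case: (split_ordP v) => i ->.
    have : i \in S :|: T by rewrite ST inE.
    rewrite inE => /orP[] h; [rewrite map_f ?mem_enum //|].
    by rewrite [X in [|| _, _ | X]]map_f ?mem_enum // !orbT.
  by rewrite [X in [|| _, X | _]]map_f ?mem_enum // !orbT.
have ltq v : index v q < n + N by rewrite -[X in _ < X]sq index_mem.
pose pi v := Ordinal (ltq v).
have pi_inj : injective pi.
  by move=> u v [e]; rewrite -(nth_index u (inq u)) e nth_index.
exists pi; first exact: injF_bij.
(* The product becomes a sum of [N] over the cut arcs. Each is long enough: its tail has index below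
   [#|S|], its head index at least [#|S| + N]. *)
rewrite sum_pad -sum_nat_const.
rewrite big_mkcond [leqRHS]big_mkcond; apply: leq_sum => e _.
rewrite inE; case: (e \in arcs D) => //=; case: andP => [[e1 e2]|//].
rewrite /length /=.
have i1 : index (lshift N e.1) q < #|S|.
  by rewrite index_cat map_f ?mem_enum // -sq1 index_mem map_f // mem_enum.
have i2 : #|S| + N <= index (lshift N e.2) q.
  have n1 : lshift N e.2 \notin q1.
    by rewrite mem_map ?mem_enum ?(disjointFl dST) //; apply: lshift_inj.
  have n2 : lshift N e.2 \notin q2.
    by apply/mapP => -[i _ /eqP]; rewrite eq_lrshift.
  rewrite index_cat (negPf n1) index_cat (negPf n2) sq1 [size q2]sq2; lia.
have sub_le a b c : a < c -> c + N <= b -> N <= b - a by lia.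
exact: sub_le i1 i2.
Qed.

Lemma arrangement_dicut (D : digraph) (k : nat)
    (pi : 'I_(dg_order D + N) -> 'I_(dg_order D + N)) :
  dg_order D ^ 3 < N -> k * N <= \sum_(e in arcs (pad D)) length pi e ->
  exists S T : {set 'I_(dg_order D)},
    [/\ S :|: T = setT, [disjoint S & T]
      & k <= #|[set e in arcs D | (e.1 \in S) && (e.2 \in T)]|].
Proof.
set n := dg_order D in pi * => ltN.
rewrite sum_pad.
pose left (i : 'I_(n + N)) := [set u : 'I_n | pi (lshift N u) <= i].
pose cut i := #|[set e in arcs D | (e.1 \in left i) && (e.2 \in ~: left i)]|.
(* Double counting: an arc is cut by exactly the splits from the position of its tail to just before
   that of its head; a backward arc is cut by none. *)
have lenE e : length pi (pad_arc e) =
    \sum_(i < n + N) ((e.1 \in left i) && (e.2 \in ~: left i)).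
  rewrite /length /=; set a := pi _; set b := pi _.
  transitivity (\sum_(0 <= i < n + N) ((b <= i) && (i < a))).
    have le_a : a <= n + N by apply: ltnW.
    case: (leqP b a) => ba; last first.
      rewrite big1_seq; last by move=> i _; lia.
      by lia.
    rewrite (big_cat_nat _ (n := b)) //=; last by lia.
    rewrite (big_cat_nat _ (m := b) (n := a)) //=.
    rewrite big1_seq; last by move=> i; rewrite mem_index_iota; lia.
    rewrite [X in _ + (_ + X)]big1_seq; last by move=> i; rewrite mem_index_iota; lia.
    rewrite (eq_big_nat _ _ (F2 := fun=> 1)); last by move=> i; lia.
    by rewrite sum_nat_const_nat; lia.
  by rewrite big_mkord; apply: eq_bigr => i _; rewrite /left !inE -ltnNge.
rewrite (eq_bigr _ (fun e _ => lenE e)) exchange_big /=.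
have cutE i : \sum_(e in arcs D) ((e.1 \in left i) && (e.2 \in ~: left i)) = cut i.
  rewrite /cut -sum1_card big_mkcond [RHS]big_mkcond /=.
  have bE (b : bool) : b = (if b then 1 else 0) :> nat by case: b.
  by apply: eq_bigr => e _; rewrite !inE; case: (e \in arcs D) => //=; apply: bE.
rewrite (eq_bigr _ (fun i _ => cutE i)) => le_k.
have nN0 : 0 < n + N by lia.
pose i0 := [arg max_(i > Ordinal nN0) cut i].
have max_i0 i : cut i <= cut i0 by rewrite /i0; case: arg_maxnP => // m _; apply.
have lesum : \sum_(i < n + N) cut i <= (n + N) * cut i0.
  rewrite -[X in X * _]card_ord -sum_nat_const; exact: leq_sum.
have cut_le : cut i0 <= n ^ 2.
  by apply: leq_trans (max_card _) _; rewrite card_prod card_ord.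
exists (left i0), (~: left i0); split; first exact: setUCr.
  by rewrite -setI_eq0 setICr.
change (k <= cut i0); rewrite leqNgt; apply/negP => ltk.
(* With [c] the largest cut, [c * n <= n ^ 3 < N], so [(n + N) * c < c.+1 * N <= k * N], which
   contradicts [lesum]. *)
have h1 : cut i0 * n <= n ^ 3 by rewrite expnSr leq_mul2r cut_le orbT.
have h2 : (cut i0).+1 * N <= k * N by rewrite leq_mul2r ltk orbT.
have h3 := leq_trans h2 (leq_trans le_k lesum).
nia.
Qed.

End Padding.

Lemma has_dicut_pad (D : digraph) (k : int) N : dg_order D ^ 3 < N ->
  has_dicut (D, k) <-> has_linear_arrangement (pad N D, k * N%:Z)%R.
Proof.
move=> ltN; split.
  case=> [S [T [ST dST le_k]]]; have [pi bpi h] := dicut_arrangement N ST dST.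
  exists pi => //; rewrite sum_maxE.
  by apply: le_trans (ler_wpM2r _ le_k) _ => //; rewrite -PoszM lez_nat.
case=> pi _; rewrite sum_maxE => h.
(* A negative [k] is replaced by 0, for which the bound on the arrangement is trivial. *)
have [k' k'E] : exists k' : nat, Num.max 0%R k = Posz k'.
  by exists `|Num.max 0%R k|%N; rewrite gez0_abs // le_max lexx.
have [|S [T [ST dST le_k]]] := @arrangement_dicut N D k' pi ltN.
  by rewrite -lez_nat PoszM -k'E; case: (lerP 0%R k).
exists S, T; split=> //; apply: (@le_trans _ _ (Posz k')); last by rewrite lez_nat.
by rewrite -k'E le_max lexx orbT.
Qed.

(** * Bit encodings of the padded digraph and of shifted integers *)

Lemma enum_ord_add n N : enum 'I_(n + N) =
  map (@lshift n N) (enum 'I_n) ++ map (@rshift n N) (enum 'I_N).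
Proof.
apply: (inj_map val_inj).
rewrite val_enum_ord map_cat iotaD; congr (_ ++ _).
  transitivity (map (@nat_of_ord n) (enum 'I_n)); first by rewrite val_enum_ord.
  by elim: (enum 'I_n) => //= i s ->.
rewrite add0n -[n in LHS]addn0 iotaDl.
transitivity (map (addn n) (map (@nat_of_ord N) (enum 'I_N))).
  by rewrite val_enum_ord.
by elim: (enum 'I_N) => //= i s ->.
Qed.

Definition arc_row (D : digraph) u := [seq (u, v) \in arcs D | v <- enum 'I_(dg_order D)].

Lemma map_const (T1 T2 : Type) (x : T2) (s : seq T1) :
  [seq x | _ <- s] = nseq (size s) x.
Proof. by elim: s => //= _ s ->. Qed.

Lemma flatten_nseq (T : Type) m p (x : T) :
  flatten (nseq m (nseq p x)) = nseq (m * p) x.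
Proof. by elim: m => //= m IH; rewrite mulSn nseqD IH. Qed.

(** Old vertices precede new ones in [enum], so only the first diagonal block of the matrix can be
    nonzero. This is the row-by-row form that the program emits. *)
Lemma adjacency_bits_pad D N : adjacency_bits (pad N D) =
  flatten [seq arc_row u ++ nseq N false | u <- enum 'I_(dg_order D)]
  ++ nseq (N * (dg_order D + N)) false.
Proof.
set n := dg_order D.
have inl u v : ((lshift N u, lshift N v) \in arcs (pad N D)) = ((u, v) \in arcs D).
  by apply: (mem_imset _ (u, v)); apply: pad_arc_inj.
have inr1 u x : ((rshift n u, x) \in arcs (pad N D)) = false.
  apply/imsetP => -[[a b] _ /(congr1 (fun e => val e.1)) /= e].
  by have := ltn_ord a; rewrite -e ltnNge leq_addr.
have inr2 u x : ((x, rshift n u) \in arcs (pad N D)) = false.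
  apply/imsetP => -[[a b] _ /(congr1 (fun e => val e.2)) /= e].
  by have := ltn_ord b; rewrite -e ltnNge leq_addr.
rewrite /adjacency_bits /arc_row /= -/n enum_ord_add.
move: (enum 'I_n) (enum 'I_N) (size_enum_ord n) (size_enum_ord N) => sn sN szn szN.
rewrite map_cat flatten_cat -!map_comp; congr (_ ++ _).
  congr flatten; apply: eq_map => u /=; rewrite map_cat -!map_comp; congr (_ ++ _).
    by apply: eq_map => v /=; rewrite inl.
  rewrite (eq_map (g := fun=> false)); last by move=> v /=; rewrite inr2.
  by rewrite map_const szN.
rewrite (eq_map (g := fun=> nseq (n + N) false)).
  by rewrite map_const szN flatten_nseq.
move=> u /=; rewrite map_cat -!map_comp nseqD.
rewrite -[X in nseq X _]szn -[X in _ ++ nseq X _]szN -!(map_const false).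
by congr (_ ++ _); apply: eq_map => v /=; rewrite inr1.
Qed.

(** The least significant bit comes first, so doubling a positive number prepends a zero; 0 keeps
    its empty word. *)
Lemma nat_bits_shift e m : 0 < m -> nat_bits (m * 2 ^ e) = nseq e false ++ nat_bits m.
Proof.
move=> m_gt0; elim: e => [|e IH]; first by rewrite muln1.
rewrite expnSr mulnA muln2 /= -IH.
have : 0 < m * 2 ^ e by rewrite muln_gt0 m_gt0 expn_gt0.
move: (m * 2 ^ e) => {m_gt0 IH e}m m_gt0; rewrite /nat_bits.
case e : (bin_of_nat m) => [|p]; 
  first by move: m_gt0; rewrite -[m]bin_of_natK e.
suff -> : bin_of_nat m.*2 = Npos (xO p) by [].
apply: (can_inj nat_of_binK).
by rewrite bin_of_natK -[in LHS](bin_of_natK m) e /= NatTrec.doubleE.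
Qed.

(** * Stack programs and their Turing machines *)

Section StackPrograms.
Variable L : nat.

Inductive prog :=
  | Push of 'I_L.+1 & bool
  | Pop of 'I_L.+1
  | Move of 'I_L.+1 & 'I_L.+1
  | Seq of prog & prog
  | While of 'I_L.+1 & pred (option bool) & prog.

Implicit Types (i j : 'I_L.+1) (p q : prog) (s : seq (seq bool)).

Definition push s i b := set_nth [::] s i (b :: nth [::] s i).
Definition pop s i := set_nth [::] s i (behead (nth [::] s i)).
Definition top s i := ohead (nth [::] s i).

(* [s] lists the stacks. [exec p s t s'] also holds for every [t] above the
   actual cost, so that costs can be rounded up along the way. *)
Inductive exec : prog -> seq (seq bool) -> nat -> seq (seq bool) -> Prop :=
  | ExecPush i b s t : 2 <= t -> exec (Push i b) s t (push s i b)
  | ExecPop i s t : 1 <= t -> exec (Pop i) s t (pop s i)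
  | ExecMove i j s t b : i != j -> top s i = Some b -> 2 <= t ->
      exec (Move i j) s t (push (pop s i) j b)
  | ExecSeq p q s1 s2 s3 t1 t2 t : exec p s1 t1 s2 -> exec q s2 t2 s3 ->
      t1 + t2 <= t -> exec (Seq p q) s1 t s3
  | ExecWhile0 i (f : pred (option bool)) p s t : ~~ f (top s i) -> 1 <= t ->
      exec (While i f p) s t s
  | ExecWhileS i (f : pred (option bool)) p s1 s2 s3 t1 t2 t :
      f (top s1 i) -> exec p s1 t1 s2 -> exec (While i f p) s2 t2 s3 -> (t1 + t2).+1 <= t ->
      exec (While i f p) s1 t s3.

Local Notation symbols := {ffun 'I_L.+1 -> option bool}.
Local Notation actions := {ffun 'I_L.+1 -> option bool * move}.

(** [bool] tells apart the two steps of pushing: move the head left, then write. The extra state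
    [None] of a loop is the one that performs the test. *)
Fixpoint state p : finType :=
  match p with
  | Push _ _ | Move _ _ => bool
  | Pop _ => unit
  | Seq p q => (state p + state q)%type
  | While _ _ p => option (state p)
  end.

Fixpoint start p : state p :=
  match p with
  | Push _ _ | Move _ _ => false
  | Pop _ => tt
  | Seq p q => inl (start p)
  | While _ _ p => None
  end.

Definition idle (g : symbols) : actions := [ffun k => (g k, Stay)].

Definition act_on (g : symbols) i (a : option bool * move) : actions :=
  [ffun k => if k == i then a else (g k, Stay)].

(* The next state is [None] when the program terminates. *)
Fixpoint delta p : state p -> symbols -> option (state p) * actions :=
  match p with
  | Push i b => fun x g =>
      if x then (None, act_on g i (Some b, Stay))
      else (Some true, act_on g i (g i, MoveL))
  | Pop i => fun _ g => (None, act_on g i (None, MoveR))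
  | Move i j => fun x g =>
      if x then (None, [ffun k => if k == i then (None, MoveR)
                                  else if k == j then (g i, Stay)
                                  else (g k, Stay)])
      else (Some true, act_on g j (g j, MoveL))
  | Seq p q => fun x g =>
      match x with
      | inl y => let: (z, a) := delta y g in
                 (Some (if z is Some z then inl z else inr (start q)), a)
      | inr y => let: (z, a) := delta y g in (omap inr z, a)
      end
  | While i f p => fun x g =>
      if x is Some y then let: (z, a) := delta y g in (Some z, a)
      else (if f (g i) then Some (Some (start p)) else None, idle g)
  end.

Definition machine p : turing_machine :=
  @TuringMachine L (option (state p) : finType) (option bool : finType) None Some
  (fun x y => @Some_inj _ x y) (fun b => isT) (Some (start p)) (fun x => ~~ isSome x)
  (fun x g => if x is Some y then delta y g else (None, idle g)).

(** * Simulation of stack programs by Turing machines *)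

Section Simulation.
(* All machines have the same alphabet, so that a program and its parts can run
   on the same tapes; [act1] is [tape_act] for any of these machines. *)
Local Notation cell_tape := (seq (option bool) * seq (option bool))%type.
Local Notation tapes := {ffun 'I_L.+1 -> cell_tape}.

Definition scan (c : tapes) : symbols := [ffun k => head None (c k).2].

Definition act1 (a : option bool * move) (t : cell_tape) : cell_tape :=
  match a.2 with
  | MoveL => (behead t.1, head None t.1 :: a.1 :: behead t.2)
  | Stay => (t.1, a.1 :: behead t.2)
  | MoveR => (a.1 :: t.1, behead t.2)
  end.

Definition act (a : actions) (c : tapes) : tapes := [ffun k => act1 (a k) (c k)].

(** Stated through [delta] alone, so that a run of a part lifts to the sequence or loop containing
    it. *)
Inductive run p : state p -> tapes -> nat -> tapes -> Prop :=
  | RunExit x c a : delta x (scan c) = (None, a) -> run x c 1 (act a c)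
  | RunStep x y c a t c' : delta x (scan c) = (Some y, a) ->
      run y (act a c) t c' -> run x c t.+1 c'.

Lemma run_inr p q (x : state q) c t c' :
  run x c t c' -> run (inr x : state (Seq p q)) c t c'.
Proof.
elim=> {x c t c'} [x c a e|x y c a t c' e _ IH].
  by apply: (@RunExit (Seq p q)); rewrite /= e.
by apply: (@RunStep (Seq p q) _ (inr y) _ a) => //=; rewrite e.
Qed.

Lemma run_seq p q (x : state p) c t c' u c'' :
  run x c t c' -> run (start q) c' u c'' ->
  run (inl x : state (Seq p q)) c (t + u) c''.
Proof.
move=> H H2; elim: H H2 => {x c t c'} [x c a e|x y c a t c' e _ IH] H2.
  apply: (@RunStep (Seq p q) _ (inr (start q)) _ a); first by rewrite /= e.
  exact: run_inr.
apply: (@RunStep (Seq p q) _ (inl y) _ a); first by rewrite /= e.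
exact: IH.
Qed.

Lemma run_while i f p (x : state p) c t c' u c'' :
  run x c t c' -> run (None : state (While i f p)) c' u c'' ->
  run (Some x : state (While i f p)) c (t + u) c''.
Proof.
move=> H H2; elim: H H2 => {x c t c'} [x c a e|x y c a t c' e _ IH] H2.
  by apply: (@RunStep (While i f p) _ None _ a) => //=; rewrite e.
apply: (@RunStep (While i f p) _ (Some y) _ a); first by rewrite /= e.
exact: IH.
Qed.

Lemma tm_step_machine p (x : state p) (c : tapes) :
  @tm_step (machine p) (Some x, c) =
  let: (y, a) := delta x (scan c) in (y, act a c).
Proof. by []. Qed.

Lemma run_machine p (x : state p) (c : tapes) t c' : run x c t c' ->
  iter t (@tm_step (machine p)) (Some x, c) = (None, c').
Proof.
elim=> {x c t c'} [x c a e|x y c a t c' e _ IH].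
  by rewrite /= tm_step_machine e.
by rewrite iterSr tm_step_machine e.
Qed.

(** Popping, and idling on an empty stack, leave explicit blanks, so the blank part of a tape need
    not be an empty list. *)
Definition blank_seq := all (fun x : option bool => ~~ isSome x).

(* The top of the stack is under the head; everything else is blank. *)
Definition holds (w : seq bool) (t : cell_tape) :=
  blank_seq t.1 /\ exists2 r, t.2 = map Some w ++ r & blank_seq r.

Definition represents s (c : tapes) := forall k : 'I_L.+1, holds (nth [::] s k) (c k).

Lemma holds_scan w (t : cell_tape) : holds w t -> head None t.2 = ohead w.
Proof. by case=> _ [r ->]; case: w => //=; case: r => //= -[]. Qed.

Lemma blank_behead r : blank_seq r -> blank_seq (behead r).
Proof. by case: r => //= x r /andP[]. Qed.

Lemma holds_stay w (t : cell_tape) : holds w t -> holds w (act1 (head None t.2, Stay) t).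
Proof.
move=> h; have e := holds_scan h; case: h => h1 [r e2 hr]; split=> //=.
rewrite e; case: w e2 {e} => [|b w] /= ->; last by exists r.
by exists (None :: behead r); rewrite //=; apply: blank_behead.
Qed.

Lemma holds_pop w (t : cell_tape) : holds w t -> holds (behead w) (act1 (None, MoveR) t).
Proof.
case=> h1 [r e hr]; split=> //=.
case: w e => [|b w] /= ->; last by exists r.
by exists (behead r) => //; apply: blank_behead.
Qed.

Lemma holds_push w (t : cell_tape) b :
  holds w t -> holds (b :: w) (act1 (Some b, Stay) (act1 (head None t.2, MoveL) t)).
Proof.
move=> h; have [h1 [r e hr]] := holds_stay h; split=> /=.
  by case: h => /blank_behead.
by exists r => //; move: e => /= ->.
Qed.

Lemma represents_upd s c (c' : tapes) i w :
  represents s c -> holds w (c' i) ->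
  (forall k, k != i -> holds (nth [::] s k) (c' k)) ->
  represents (set_nth [::] s i w) c'.
Proof.
move=> h hi hk k; rewrite nth_set_nth /=; case: eqP => [/val_inj -> //|/eqP ne].
exact: hk.
Qed.

Lemma represents_idle s c : represents s c -> represents s (act (idle (scan c)) c).
Proof. by move=> h k; rewrite !ffunE; apply: holds_stay. Qed.

Lemma scan_top s c i : represents s c -> scan c i = top s i.
Proof. by move=> h; rewrite ffunE; apply: holds_scan. Qed.

(** By induction on the execution; a loop tests while all tapes idle. The true time [u] may be below
    [t], since [exec] rounds costs up. *)
Lemma exec_run p s t s' c : exec p s t s' -> represents s c ->
  exists u c', [/\ u <= t, run (start p) c u c' & represents s' c'].
Proof.
move=> H; elim: H c => {p s t s'}.
- move=> i b s t le2t c rep; exists 2; eexists; split=> //.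
    by apply: RunStep => //; apply: RunExit.
  apply: (represents_upd rep).
    by rewrite !ffunE eqxx /=; apply: holds_push.
  move=> k /negPf ne; rewrite !ffunE ne /= -/(act1 _ _).
  by apply: (@holds_stay _ (act1 (_, Stay) (c k))); apply: holds_stay.
- move=> i s t le1t c rep; exists 1; eexists; split=> //; first exact: RunExit.
  apply: (represents_upd rep).
    by rewrite !ffunE eqxx; apply: holds_pop.
  by move=> k /negPf ne; rewrite !ffunE ne; apply: holds_stay.
- move=> i j s t b nij tb le2t c rep; exists 2; eexists; split=> //.
    by apply: RunStep => //; apply: RunExit.
  rewrite /push nth_set_nth /= eq_sym val_eqE (negPf nij).
  have hi : scan c i = Some b by rewrite (scan_top i rep).
  move=> k; rewrite !nth_set_nth /= nth_set_nth /= !val_eqE !ffunE.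
  have [->|nkj] := eqVneq k j.
    rewrite eq_sym (negPf nij) /=.
    move: hi; rewrite ffunE => ->; exact: holds_push.
  have [->|nki] := eqVneq k i.
    rewrite /=; apply: (@holds_pop _ (act1 (_, Stay) (c i))); exact: holds_stay.
  by apply: (@holds_stay _ (act1 (_, Stay) (c k))); apply: holds_stay.
- move=> p q s1 s2 s3 t1 t2 t _ IH1 _ IH2 le_t c rep.
  have [u1 [c1 [le1 r1 rep1]]] := IH1 _ rep.
  have [u2 [c2 [le2 r2 rep2]]] := IH2 _ rep1.
  exists (u1 + u2), c2; split=> //; first by apply: leq_trans le_t; apply: leq_add.
  exact: run_seq r1 r2.
- move=> i f p s t nf le1t c rep; exists 1, (act (idle (scan c)) c).
  split=> //; last exact: represents_idle.
  by apply: RunExit; rewrite /= (scan_top i rep) (negPf nf).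
- move=> i f p s1 s2 s3 t1 t2 t hf _ IH1 _ IH2 le_t c rep.
  have [u1 [c1 [le1 r1 rep1]]] := IH1 _ (represents_idle rep).
  have [u2 [c2 [le2 r2 rep2]]] := IH2 _ rep1.
  exists (u1 + u2).+1, c2; split=> //.
    by apply: leq_trans le_t; rewrite ltnS; apply: leq_add.
  apply: (@RunStep (While i f p) None (Some (start p)) _ (idle (scan c))); last exact: run_while r1 r2.
  by rewrite /= (scan_top i rep) hf.
Qed.

Lemma exec_outputs_within p w t s : exec p (w :: nseq L [::]) t s ->
  outputs_within (machine p) w t (nth [::] s L).
Proof.
move=> ex.
have rep : represents (w :: nseq L [::]) (tm_init (machine p) w).2.
  move=> k; rewrite ffunE -val_eqE /=; case: (val k) => [|m] /=.
    by split=> //; exists [::]; rewrite ?cats0.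
  by rewrite nth_nseq if_same; split=> //; exists [::].
have [u [c [le_u r rep']]] := exec_run ex rep.
exists u => //=; rewrite {1 2}/tm_init /= in r *.
have := run_machine r; rewrite /tm_init /= => ->; split=> //.
have [_ [r' e b]] := rep' ord_max; exists r' => //.
by case: r' b {e} => //= -[].
Qed.

End Simulation.
End StackPrograms.

(** * The reduction as a stack program *)

Declare Scope prog_scope.
Delimit Scope prog_scope with P.
Notation "p ;; q" := (Seq p q) (at level 60, right associativity) : prog_scope.

(** * Executions and costs of basic loops *)

Section Loops.
Variable L : nat.
Implicit Types (i j : 'I_L.+1) (p : prog L).

Definition nonempty (x : option bool) := isSome x.
Definition while_some i p := While i nonempty p.
Definition transfer i j := while_some i (Move i j).

Lemma exec_push i b s : exec (Push i b) s 2 (push s i b).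
Proof. exact: ExecPush. Qed.

Lemma exec_pop i s : exec (Pop i) s 1 (pop s i).
Proof. exact: ExecPop. Qed.

Lemma exec_move i j s s' b w : i != j -> nth [::] s i = b :: w ->
  s' = push (pop s i) j b -> exec (Move i j) s 2 s'.
Proof. by move=> nij e ->; apply: ExecMove; rewrite // /top e. Qed.

Lemma exec_leq p s t u s' : exec p s t s' -> t <= u -> exec p s u s'.
Proof.
move=> H; case: H u => {p s t s'}.
- by move=> i b s t h u h'; apply: ExecPush; apply: leq_trans h'.
- by move=> i s t h u h'; apply: ExecPop; apply: leq_trans h'.
- by move=> i j s t b n e h u h'; apply: ExecMove e _; rewrite ?(leq_trans h h').
- by move=> p q s1 s2 s3 t1 t2 t e1 e2 h u h'; apply: ExecSeq e1 e2 (leq_trans h h').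
- by move=> i f p s t n h u h'; apply: ExecWhile0 n (leq_trans h h').
- move=> i f p s1 s2 s3 t1 t2 t n e1 e2 h u h'.
  exact: ExecWhileS n e1 e2 (leq_trans h h').
Qed.

(** [inv a b] describes the stacks with [a] rounds to go and [b] done. Each round costs [t] and one
    step for its test; the last unit is the failing test. *)
Lemma exec_for i (f : pred (option bool)) p t (inv : nat -> nat -> seq (seq bool)) a b :
  (forall a b, f (top (inv a.+1 b) i)) -> (forall b, ~~ f (top (inv 0 b) i)) ->
  (forall a b, exec p (inv a.+1 b) t (inv a b.+1)) ->
  exec (While i f p) (inv a b) (a * t.+1).+1 (inv 0 (a + b)).
Proof.
move=> fS f0 step; elim: a b => [|a IH] b; first exact: ExecWhile0.
apply: (ExecWhileS (fS _ _) (step a b)); first by rewrite addSnnS; apply: IH.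
by rewrite mulSn; lia.
Qed.

(** Three steps per bit: two to move, one to test. The reversal of the bits is harmless for unary
    counters and is what the reversed output stack needs. *)
Lemma exec_transfer i j s : i != j -> i < size s -> j < size s ->
  exec (transfer i j) s (3 * size (nth [::] s i)).+1
    (set_nth [::] (set_nth [::] s i [::]) j (rev (nth [::] s i) ++ nth [::] s j)).
Proof.
move=> nij; move e : (nth [::] s i) => w; elim: w s e => [|b w IH] s e si sj.
  (* With an empty source, both updates write back what is there; the index bounds keep [set_nth]
     from lengthening the list. *)
  rewrite (_ : set_nth _ _ _ _ = s); first by apply: ExecWhile0; rewrite // /top e.
  apply: (@eq_from_nth _ [::]) => [|k _].
    by rewrite !size_set_nth; move: si sj; rewrite /leq; lia.
  rewrite !nth_set_nth /= ?nth_set_nth /=.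
  by case: eqP => [->|_] //; case: eqP => [->|].
pose s' := push (pop s i) j b.
have ei : nth [::] s' i = w.
  by rewrite /s' /push /pop !nth_set_nth /= val_eqE (negPf nij) ?nth_set_nth /= eqxx e.
have ej : nth [::] s' j = b :: nth [::] s j.
  by rewrite /s' /push /pop !nth_set_nth /= eqxx ?nth_set_nth /= val_eqE eq_sym (negPf nij).
have ek (k : nat) : k <> i -> k <> j -> nth [::] s' k = nth [::] s k.
  move=> /eqP/negPf nki /eqP/negPf nkj.
  by rewrite /s' /push nth_set_nth /= nkj /pop nth_set_nth /= nki.
have ss : size s' = size s.
  by rewrite /s' !size_set_nth; move: si sj; lia.
have ex : exec (Move i j) s 2 s' by apply: exec_move e _.
clearbody s'.
apply: (@ExecWhileS _ _ _ _ _ _ _ _ (3 * size w).+1 _ _ ex).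
- by rewrite /top e.
- rewrite (_ : set_nth _ _ _ _ =
      set_nth [::] (set_nth [::] s' i [::]) j (rev w ++ nth [::] s' j)).
    by apply: IH => //; rewrite ss.
  apply: (@eq_from_nth _ [::]) => [|k _].
    by rewrite size_set_nth size_set_nth [RHS]size_set_nth [in RHS]size_set_nth ss.
  rewrite !nth_set_nth /= !nth_set_nth /= ej rev_cons cat_rcons.
  by case: eqP => // nkj; case: eqP => // nki; rewrite ek.
- by rewrite /=; lia.
Qed.

End Loops.

(* [In]: the input; [Out]: the output; [X]: the output, reversed. In unary: [U],
   [R], [H] start as the order n and [V] ends as the number N of new vertices, with
   [R], [H] and the copy [Z] of [V] consumed as loop counters. [J]: log2 N zeros.
   [W]: scratch. *)
Local Notation In := (@Ordinal 10 0 isT).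
Local Notation U := (@Ordinal 10 1 isT).
Local Notation R := (@Ordinal 10 2 isT).
Local Notation H := (@Ordinal 10 3 isT).
Local Notation V := (@Ordinal 10 4 isT).
Local Notation Z := (@Ordinal 10 5 isT).
Local Notation W := (@Ordinal 10 6 isT).
Local Notation J := (@Ordinal 10 7 isT).
Local Notation X := (@Ordinal 10 8 isT).
Local Notation Out := (@Ordinal 10 9 isT).

Local Open Scope prog_scope.

Definition read_order : prog 9 :=
  While In (pred1 (Some true)) (Pop In ;; Push U true ;; Push R true ;; Push H true).

(** [Pop] does nothing on an empty stack, so an incomplete last pair still counts; the initial [Pop]
    turns this rounding up into the floor of the half. *)
Definition halve : prog 9 :=
  Pop H ;; while_some H (Pop H ;; Pop H ;; Push W true) ;; transfer W H.

Definition times8 : prog 9 :=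
  while_some V (Pop V ;;
    Push W true ;; Push W true ;; Push W true ;; Push W true ;;
    Push W true ;; Push W true ;; Push W true ;; Push W true) ;;
  transfer W V.

(* Multiplies [V] by 8 and adds three zeros to [J] once per binary digit of [H]. *)
Definition log_loop : prog 9 :=
  while_some H (halve ;; Push J false ;; Push J false ;; Push J false ;; times8).

(** The counter is parked in [W] and brought back, because it is read again for later rows. *)
Definition emit_for (i : 'I_10) b : prog 9 :=
  while_some i (Move i W ;; Push X b) ;; transfer W i.

Definition emit_order : prog 9 :=
  emit_for U true ;;
  while_some V (Move V W ;; Push Z true ;; Push X true) ;; transfer W V ;;
  Push X false.

Definition emit_row : prog 9 :=
  while_some U (Move U W ;; Move In X) ;; transfer W U ;; emit_for V false.

Definition emit_rows : prog 9 := while_some R (Pop R ;; emit_row).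

Definition emit_zero_rows : prog 9 :=
  while_some Z (Pop Z ;; emit_for U false ;; emit_for V false).

(* The loop runs at most once: it skips the zeros of [J] when the integer is 0,
   whose binary notation is the empty word. *)
Definition emit_int : prog 9 :=
  Move In X ;; while_some In (transfer J X ;; transfer In X).

Definition reduction : prog 9 :=
  read_order ;; Pop In ;; Push V true ;; log_loop ;; emit_order ;;
  emit_rows ;; emit_zero_rows ;; emit_int ;; transfer X Out.

(** * Correctness and cost of the parts of the reduction *)

Ltac step := first [exact: exec_push | exact: exec_pop |
  by eapply exec_move; [exact isT|reflexivity|reflexivity]].
Ltac steps := first [step | eapply ExecSeq; [by step | steps | exact: leqnn]].

Lemma exec_read_order n w :
  exec read_order [:: nseq n true ++ false :: w; [::]; [::]; [::]; [::]; [::]; [::]; [::]; [::]; [::]]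
    (n * 8).+1
    [:: false :: w; nseq n true; nseq n true; nseq n true; [::]; [::]; [::]; [::]; [::]; [::]].
Proof.
have := @exec_for 9 In (pred1 (Some true)) (Pop In ;; Push U true ;; Push R true ;; Push H true) 7
  (fun a b => [:: nseq a true ++ false :: w; nseq b true; nseq b true; nseq b true; [::]; [::]; [::]; [::]; [::]; [::]]) n 0.
rewrite addn0; apply => //.
by move=> a b; steps.
Qed.

Lemma exec_halve h i u r v z j x o :
  exec halve [:: i; u; r; nseq h.+1 true; v; z; [::]; j; x; o] (8 * h + 10)
    [:: i; u; r; nseq h.+1./2 true; v; z; [::]; j; x; o].
Proof.
have loop g b : exec (while_some H (Pop H ;; Pop H ;; Push W true))
    [:: i; u; r; nseq g true; v; z; nseq b true; j; x; o] (5 * g).+1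
    [:: i; u; r; [::]; v; z; nseq (uphalf g + b) true; j; x; o].
  (* Strong induction, since a round takes two units off the counter, or the only one left. *)
  elim/ltn_ind: g b => -[_ b|g IH b]; first exact: ExecWhile0.
  apply: (@ExecWhileS 9 H _ _ _
    [:: i; u; r; nseq g.-1 true; v; z; nseq b.+1 true; j; x; o] _ 4 (5 * g.-1).+1) => //.
  - by case: g {IH} => [|g]; steps.
  - case: g IH => [|g] IH; first exact: IH.
    rewrite (_ : uphalf g.+2 + b = uphalf g + b.+1); last by rewrite addnS.
    exact: IH.
  - by case: g {IH} => [|g] /=; lia.
apply: ExecSeq; [exact: exec_pop| |].
  apply: ExecSeq; [exact: (loop h 0)| |exact: leqnn].
  rewrite addn0.
  have := @exec_transfer 9 W H [:: i; u; r; [::]; v; z; nseq (uphalf h) true; j; x; o] isT isT isT.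
  by rewrite /= rev_nseq cats0 size_nseq; apply.
by have := leq_uphalf_double h h; lia.
Qed.

(** Per unit of [v], 18 steps in the loop and 24 to bring its eight copies back. *)
Lemma exec_times8 i u r h v z j x o :
  exec times8 [:: i; u; r; h; nseq v true; z; [::]; j; x; o] (42 * v + 2)
    [:: i; u; r; h; nseq (v * 8) true; z; [::]; j; x; o].
Proof.
apply: ExecSeq.
- apply: (@exec_for 9 V _ _ 17 (fun a b =>
    [:: i; u; r; h; nseq a true; z; nseq (b * 8) true; j; x; o]) v 0) => // a b.
  by steps.
- have := @exec_transfer 9 W V
    [:: i; u; r; h; [::]; z; nseq (v * 8) true; j; x; o] isT isT isT.
  by rewrite addn0 /= rev_nseq cats0 size_nseq; apply.
- by lia.
Qed.

(** The number of binary digits of [n], which is how often it can be halved before reaching 0. *)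
Definition nbits n := up_log 2 n.+1.

Lemma nbitsS h : nbits h.+1 = (nbits h.+1./2).+1.
Proof. exact: up_log2S. Qed.

(** The bound is crude: [h] rounds instead of [nbits h], each charged as if [V] already had its
    final size. *)
Lemma exec_log_loop h i u r v z j x o :
  exec log_loop [:: i; u; r; nseq h true; nseq v true; z; [::]; j; x; o]
    (h * (8 * h + 42 * (v * 8 ^ nbits h) + 20)).+1
    [:: i; u; r; [::]; nseq (v * 8 ^ nbits h) true; z; [::];
        nseq (3 * nbits h) false ++ j; x; o].
Proof.
elim/ltn_ind: h v j => -[_ v j|h IH v j].
  by rewrite muln1; apply: ExecWhile0.
rewrite nbitsS; set k := nbits _.
have eK : v * 8 ^ k.+1 = v * 8 * 8 ^ k by rewrite expnS mulnA.
have half_le : h.+1./2 <= h by rewrite -uphalfE leq_uphalf_double -addnn leq_addr.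
apply: (@ExecWhileS 9 H _ _ _
  [:: i; u; r; nseq h.+1./2 true; nseq (v * 8) true; z; [::];
      [:: false, false, false & j]; x; o] _ (8 * h + 42 * v + 18)) => //.
- apply: ExecSeq; [exact: exec_halve| |].
    apply: ExecSeq; [exact: exec_push| |exact: leqnn].
    apply: ExecSeq; [exact: exec_push| |exact: leqnn].
    apply: ExecSeq; [exact: exec_push| |exact: leqnn].
    exact: exec_times8.
  by lia.
- rewrite eK; have -> : nseq (3 * k.+1) false ++ j = nseq (3 * k) false ++ [:: false, false, false & j].
    by rewrite mulnS addnC nseqD -catA.
  by apply: IH; rewrite ltnS.
- rewrite -/k eK.
  have : v * 8 <= v * 8 * 8 ^ k by rewrite leq_pmulr // expn_gt0.
  move: (v * 8 * 8 ^ k) => K vK.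
  have : h.+1./2 * (8 * h.+1./2 + 42 * K + 20) <= h * (8 * h + 42 * K + 20).
    by apply: leq_mul => //; lia.
  by rewrite mulSn; lia.
Qed.

Lemma exec_emit_U u b i r h v z j x o :
  exec (emit_for U b) [:: i; nseq u true; r; h; v; z; [::]; j; x; o] (8 * u + 2)
    [:: i; nseq u true; r; h; v; z; [::]; j; nseq u b ++ x; o].
Proof.
apply: ExecSeq.
- apply: (@exec_for 9 U _ _ 4 (fun a c =>
    [:: i; nseq a true; r; h; v; z; nseq c true; j; nseq c b ++ x; o]) u 0) => // a c.
  by steps.
- have := @exec_transfer 9 W U
    [:: i; [::]; r; h; v; z; nseq u true; j; nseq u b ++ x; o] isT isT isT.
  by rewrite addn0 /= rev_nseq cats0 size_nseq; apply.
- by lia.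
Qed.

Lemma exec_emit_V v b i u r h z j x o :
  exec (emit_for V b) [:: i; u; r; h; nseq v true; z; [::]; j; x; o] (8 * v + 2)
    [:: i; u; r; h; nseq v true; z; [::]; j; nseq v b ++ x; o].
Proof.
apply: ExecSeq.
- apply: (@exec_for 9 V _ _ 4 (fun a c =>
    [:: i; u; r; h; nseq a true; z; nseq c true; j; nseq c b ++ x; o]) v 0) => // a c.
  by steps.
- have := @exec_transfer 9 W V
    [:: i; u; r; h; [::]; z; nseq v true; j; nseq v b ++ x; o] isT isT isT.
  by rewrite addn0 /= rev_nseq cats0 size_nseq; apply.
- by lia.
Qed.

Lemma exec_emit_order u v i r h j o :
  exec emit_order [:: i; nseq u true; r; h; nseq v true; [::]; [::]; j; [::]; o]
    (8 * u + 10 * v + 6)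
    [:: i; nseq u true; r; h; nseq v true; nseq v true; [::]; j;
        false :: nseq (u + v) true; o].
Proof.
apply: ExecSeq; [exact: exec_emit_U| |].
  apply: ExecSeq.
  - apply: (@exec_for 9 V _ _ 6 (fun a c => [:: i; nseq u true; r; h; nseq a true;
      nseq c true; nseq c true; j; nseq c true ++ nseq u true ++ [::]; o]) v 0) => // a c.
    by steps.
  - apply: ExecSeq; [exact: exec_transfer| |exact: leqnn].
    rewrite addn0 /= rev_nseq !cats0 -nseqD [v + u]addnC; exact: exec_push.
  - exact: leqnn.
by rewrite /= size_nseq; lia.
Qed.

Lemma exec_emit_row row v i r h z j x o :
  exec emit_row
    [:: row ++ i; nseq (size row) true; r; h; nseq v true; z; [::]; j; x; o]
    (8 * (size row + v) + 4)
    [:: i; nseq (size row) true; r; h; nseq v true; z; [::]; j;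
        rev (row ++ nseq v false) ++ x; o].
Proof.
(* [U] counts off the bits of the row, so the rest [i] of the input stays in place. *)
have loop w c y : exec (while_some U (Move U W ;; Move In X))
    [:: w ++ i; nseq (size w) true; r; h; nseq v true; z; nseq c true; j; y; o]
    (5 * size w).+1
    [:: i; [::]; r; h; nseq v true; z; nseq (size w + c) true; j; rev w ++ y; o].
  elim: w c y => [|b w IH] c y; first exact: ExecWhile0.
  apply: (@ExecWhileS 9 U _ _ _ [:: w ++ i; nseq (size w) true; r; h; nseq v true;
    z; nseq c.+1 true; j; b :: y; o] _ 4 (5 * size w).+1) => //.
  - by steps.
  - rewrite rev_cons cat_rcons (_ : size (b :: w) + c = size w + c.+1).
      exact: IH.
    by rewrite addnS.
  - by rewrite /=; lia.
apply: ExecSeq; [exact: (loop row 0)| |].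
  apply: ExecSeq; [exact: exec_transfer| |exact: leqnn].
  rewrite addn0 /= rev_nseq cats0 rev_cat rev_nseq -catA; exact: exec_emit_V.
by rewrite /= size_nseq; lia.
Qed.

Lemma exec_emit_rows (n : nat) v rows i h z j x o : all (fun row => size row == n) rows ->
  exec emit_rows
    [:: flatten rows ++ i; nseq n true; nseq (size rows) true; h; nseq v true; z;
        [::]; j; x; o]
    (size rows * (8 * (n + v) + 6)).+1
    [:: i; nseq n true; [::]; h; nseq v true; z; [::]; j;
        rev (flatten [seq row ++ nseq v false | row <- rows]) ++ x; o].
Proof.
elim: rows x => [|row rows IH] x; first by move=> _; apply: ExecWhile0.
case/andP=> /eqP sz /IH{}IH.
have := exec_emit_row row v (flatten rows ++ i) (nseq (size rows) true) h z j x o.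
rewrite sz => ex_row.
apply: (ExecWhileS (s2 := _) _ (ExecSeq (exec_pop _ _) _ (leqnn _))) => //.
- by rewrite /pop /= -catA; apply: ex_row.
- by rewrite [flatten (map _ _)]/= [rev (_ ++ flatten _)]rev_cat -catA; apply: IH.
- by rewrite /=; lia.
Qed.

Lemma exec_emit_zero_rows n v m i r h j x o :
  exec emit_zero_rows
    [:: i; nseq n true; r; h; nseq v true; nseq m true; [::]; j; x; o]
    (m * (8 * (n + v) + 6)).+1
    [:: i; nseq n true; r; h; nseq v true; [::]; [::]; j;
        nseq (m * (n + v)) false ++ x; o].
Proof.
elim: m x => [|m IH] x; first exact: ExecWhile0.
apply: ExecWhileS => //.
- apply: ExecSeq; [exact: exec_pop| |exact: leqnn].
  apply: ExecSeq; [exact: exec_emit_U|exact: exec_emit_V|exact: leqnn].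
- rewrite mulSn nseqD -catA.
  (* All emitted bits are zeros, so the order of the blocks is immaterial. *)
  have -> : nseq (n + v) false ++ nseq (m * (n + v)) false ++ x
     = nseq (m * (n + v)) false ++ nseq v false ++ nseq n false ++ x.
    by rewrite !catA -!nseqD; congr (nseq _ _ ++ _); lia.
  exact: IH.
- by lia.
Qed.

(** The case split keeps the word of 0 empty under a shift. *)
Definition shifted_bits e (bits : seq bool) : seq bool :=
  if bits is [::] then [::] else nseq e false ++ bits.

(** [J] is emptied only when [bits] is nonempty; its final content is left existential, as it is not
    part of the output. *)
Lemma exec_emit_int sgn bits e u r h v z w x o :
  exists j, exec emit_int
    [:: sgn :: bits; u; r; h; v; z; w; nseq e false; x; o]
    (3 * e + 3 * size bits + 7)
    [:: [::]; u; r; h; v; z; w; j; rev (sgn :: shifted_bits e bits) ++ x; o].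
Proof.
case: bits => [|b bits].
  exists (nseq e false); apply: ExecSeq; [exact: exec_move|exact: (@ExecWhile0 _ _ _ _ _ 1)|lia].
exists [::]; apply: ExecSeq; [exact: exec_move| |].
  apply: ExecWhileS => //.
  - apply: ExecSeq; [exact: exec_transfer|exact: exec_transfer|exact: leqnn].
  - rewrite [shifted_bits _ _]/= [rev (sgn :: _)]rev_cons rev_cat cat_rcons -catA; exact: (@ExecWhile0 _ _ _ _ _ 1).
by rewrite /= size_nseq; lia.
Qed.

(** The cube of the least power of two above [n]. *)
Definition padded_order n := 8 ^ nbits n.

(** The encoding of the reduced instance in terms of rows and bits only, so that the program can be
    analysed without digraphs. *)
Definition padded_word n rows sgn bits :=
  let N := padded_order n in
  nseq (n + N) true ++ false :: flatten [seq row ++ nseq N false | row <- rows] ++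
  nseq (N * (n + N)) false ++ sgn :: shifted_bits (3 * nbits n) bits.

Lemma size_padded_rows (n : nat) N (rows : seq (seq bool)) : all (fun row => size row == n) rows ->
  size (flatten [seq row ++ nseq N false | row <- rows]) = size rows * (n + N).
Proof.
elim: rows => //= row rows IH /andP[/eqP sz rows_n].
by rewrite !size_cat size_nseq sz IH.
Qed.

Lemma exec_reduction (n : nat) rows sgn bits (N := padded_order n) (e := 3 * nbits n) :
  all (fun row => size row == n) rows -> size rows = n ->
  exists2 s, exec reduction
      ((nseq n true ++ false :: flatten rows ++ sgn :: bits) :: nseq 9 [::])
      (n * (8 * n + 42 * N + 20) + 4 * (n + N) * (3 * (n + N) + 8) + 6 * (e + size bits) + 50) s
    & nth [::] s 9 = padded_word n rows sgn bits.
Proof.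
move=> rows_n size_rows.
have out_size : size (shifted_bits e bits) <= e + size bits.
  by case: (bits) => //= b bs; rewrite size_cat size_nseq.
have [j ex_int] := exec_emit_int sgn bits e (nseq n true) [::] [::] (nseq N true) [::] [::]
  (nseq (N * (n + N)) false ++ rev (flatten [seq row ++ nseq N false | row <- rows]) ++
   false :: nseq (n + N) true) [::].
have := exec_log_loop n (flatten rows ++ sgn :: bits) (nseq n true) (nseq n true) 1
  [::] [::] [::] [::].
rewrite mul1n cats0 -/(padded_order n) -/N -/e => ex_log.
have := @exec_emit_rows n N rows (sgn :: bits) [::] (nseq N true) (nseq e false)
  (false :: nseq (n + N) true) [::] rows_n.
rewrite size_rows => ex_rows.
eexists.
  apply: ExecSeq; [exact: exec_read_order| |].
    apply: ExecSeq; [exact: exec_pop| |exact: leqnn].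
    apply: ExecSeq; [exact: exec_push| |exact: leqnn].
    apply: ExecSeq; [exact: ex_log| |exact: leqnn].
    apply: ExecSeq; [exact: exec_emit_order| |exact: leqnn].
    apply: ExecSeq; [exact: ex_rows| |exact: leqnn].
    apply: ExecSeq; [exact: exec_emit_zero_rows| |exact: leqnn].
    apply: ExecSeq; [exact: ex_int|exact: exec_transfer|exact: leqnn].
  (* The last transfer is charged for the whole output. In the bound, the first summand pays for
     computing [N], the second covers emitting the order and the [n + N] rows and reversing them,
     the third the integer. *)
  rewrite [nth _ _ _]/= !size_cat size_rev size_nseq size_rev (size_padded_rows N rows_n).
  rewrite size_rows [size (_ :: _)]/= [size (_ :: nseq _ _)]/= size_nseq.
  by nia.
rewrite /= cats0 rev_cat rev_cat rev_cat revK revK rev_nseq rev_cons rev_nseq.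
by rewrite cat_rcons -!catA.
Qed.

(** * Size of the padding, encoding of the reduced instance and polynomial time bound *)

Lemma nbits_le n : nbits n <= n.
Proof. by apply: up_log_min => //; apply: ltn_expl. Qed.

Lemma padded_orderE n : padded_order n = 2 ^ (3 * nbits n).
Proof. by rewrite expnM. Qed.

Lemma padded_order_gt n : n ^ 3 < padded_order n.
Proof.
by rewrite padded_orderE mulnC expnM ltn_exp2r // up_logP.
Qed.

(** For positive [n], [2 ^ nbits n <= 2 * n], which is then cubed; the added 1 covers [n = 0]. This
    keeps the unary order in the output polynomial. *)
Lemma padded_order_le n : padded_order n <= 8 * n ^ 3 + 1.
Proof.
case: n => [|n] //; rewrite addn1 leqW // padded_orderE mulnC expnM.
rewrite -[8]/(2 ^ 3) -expnMn leq_exp2r //.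
have := @up_log_gtn 2 n.+2 isT isT; rewrite -/(nbits n.+1) nbitsS /= expnS.
by rewrite ltnS; apply: leq_mul.
Qed.

Definition reduce (x : digraph * int) : digraph * int :=
  let N := padded_order (dg_order x.1) in (pad N x.1, x.2 * N%:Z)%R.

Definition arc_rows D := [seq arc_row u | u <- enum 'I_(dg_order D)].

Lemma encode_rows D k : encode_digraph_int (D, k) =
  nseq (dg_order D) true ++ false :: flatten (arc_rows D) ++ (k < 0)%R :: nat_bits `|k|%N.
Proof. by []. Qed.

Lemma int_bits_shift (k : int) e :
  int_bits (k * (2 ^ e)%N%:Z)%R = (k < 0)%R :: shifted_bits e (nat_bits `|k|%N).
Proof.
have pos_e : (0 < (2 ^ e)%N%:Z)%R by rewrite ltz_nat expn_gt0.
rewrite /int_bits pmulr_llt0 // abszM absz_nat; congr (_ :: _).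
case: (posnP `|k|%N) => [-> //|k_gt0]; rewrite nat_bits_shift //.
(* A positive number has a nonempty word, by injectivity of [nat_bits] against the empty word of
   0. *)
by rewrite /shifted_bits; 
  case: nat_bits (nat_bits_inj (x1 := `|k|%N) (x2 := 0)) => // /(_ erefl) k0;
  rewrite k0 in k_gt0.
Qed.

Lemma encode_reduce D k : encode_digraph_int (reduce (D, k)) =
  padded_word (dg_order D) (arc_rows D) (k < 0)%R (nat_bits `|k|%N).
Proof.
rewrite /padded_word -map_comp -int_bits_shift -padded_orderE.
by rewrite /encode_digraph_int /reduce [(_, _).1]/= [(_, _).2]/= adjacency_bits_pad -catA.
Qed.

Lemma reduce_polytime :
  polytime_computable encode_digraph_int encode_digraph_int reduce.
Proof.
(* With [m] the input length and [B = 8 * m ^ 3 + 1], the order, [N] and the bit counts are all at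
   most [B]; the cost is then at most [98 * B ^ 2 + 108 * B + 50], hence at most [(16 * B) ^ 2]. *)
exists (machine reduction), ((16%:P * (8%:P * 'X^3 + 1)) ^+ 2)%R => -[D k].
have rows_n : all (fun row => size row == dg_order D) (arc_rows D).
  by rewrite all_map; apply/allP => u _ /=; rewrite size_map size_enum_ord.
have size_rows : size (arc_rows D) = dg_order D by rewrite size_map size_enum_ord.
have [s ex out] := exec_reduction (k < 0)%R (nat_bits `|k|%N) rows_n size_rows.
rewrite encode_reduce -out; apply: exec_outputs_within; apply: exec_leq ex _.
have pE m : ((16%:P * (8%:P * 'X^3 + 1)) ^+ 2 : {poly nat}).[m]%R = (16 * (8 * m ^ 3 + 1)) ^ 2.
  by rewrite !(hornerE, hornerXn).
rewrite pE.
have sizeE : size (encode_digraph_int (D, k)) =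
    dg_order D + (size (flatten (arc_rows D)) + (size (nat_bits `|k|%N)).+1).+1.
  by rewrite encode_rows size_cat size_nseq /= size_cat.
move: (size _) (dg_order D) (size (nat_bits _)) sizeE => m n b sizeE.
(* The order is bounded by the input length because it is written in unary. *)
have n_le : n <= m by lia.
have b_le : b <= m by lia.
have N_le := padded_order_le n; have k_le := nbits_le n.
have n3_le : n ^ 3 <= m ^ 3 by rewrite leq_exp2r.
have m_le : m <= m ^ 3 by case: (m) => // m'; rewrite expnS leq_pmulr // expn_gt0.
move: (m ^ 3) (n ^ 3) (padded_order n) (nbits n) n3_le m_le N_le k_le => m3 n3 N e n3_le m_le N_le e_le.
have : n * (8 * n + 42 * N + 20) <= (8 * m3 + 1) * (50 * (8 * m3 + 1) + 20).
  by apply: leq_mul; lia.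
have : 4 * (n + N) * (3 * (n + N) + 8) <= (8 * (8 * m3 + 1)) * (6 * (8 * m3 + 1) + 8).
  by apply: leq_mul; lia.
have : 6 * (3 * e + b) + 50 <= 24 * (8 * m3 + 1) + 50 by lia.
have : 0 < 8 * m3 + 1 by lia.
rewrite expnMn; move: (8 * m3 + 1) => B; nia.
Qed.

Theorem theorem3p5 : polytime_many_one_reducible MaxDiCut MaxDLA.
Proof.
exists reduce => [|[D k]]; first exact: reduce_polytime.
exact/has_dicut_pad/padded_order_gt.
Qed.
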